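(* Let $p\in[2,\infty)$ and let $A,B\in M_n(\mathbb{C})$. Then: (1) $$w_p\left(\begin{bmatrix} 0 & B \\ B & 0 \end{bmatrix}\right)=2^{1/p}\,w_p(B).$$ (2) $$w_p\left(\begin{bmatrix} A & B \\ B & A \end{bmatrix}\right)\le\frac{1}{2^{\frac2p-1}}\Big(w_p^p(A+B)+w_p^p(A-B)\Big)^{1/p},$$ and if $A$ and $B$ are Hermitian, then $$w_p\left(\begin{bmatrix} A & B \\ B & A \end{bmatrix}\right)=\Big(w_p^p(A+B)+w_p^p(A-B)\Big)^{1/p}.$$
   Context: For $p\in[1,\infty)$, $\|\cdot\|_p$ denotes the Schatten $p$-norm on $M_m(\mathbb{C})$, $\|Y\|_p=(\sum_j s_j(Y)^p)^{1/p}$ with $s_j(Y)$ the singular values of $Y$. The Schatten $p$-generalized numerical radius is $w_p(Y)=\sup_{\theta\in\mathbb{R}}\|\mathrm{Re}(e^{i\theta}Y)\|_p$, where $\mathrm{Re}(Z)=\frac12(Z+Z^* )$. The notation $w_p^p(Y)$ means $(w_p(Y))^p$. Block matrices are elements of $M_{2n}(\mathbb{C})$ with $n\times n$ blocks. *)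

(* Defs.v *)
From HB Require Import structures.
From mathcomp Require Import all_boot all_order all_algebra.
From mathcomp Require Import sesquilinear spectral complex.
From mathcomp Require Import all_classical all_reals all_analysis.

Set Implicit Arguments.
Unset Strict Implicit.
Unset Printing Implicit Defensive.

Import Order.TTheory GRing.Theory Num.Theory.

Local Open Scope classical_set_scope.
Local Open Scope sesquilinear_scope.
Local Open Scope complex_scope.
Local Open Scope ring_scope.

Section SchattenNumericalRadius.
Context {R : realType} {m : nat}.
Implicit Types (Y : 'M[R[i]]_m) (p theta : R).

(* The singular values of Y are the square roots of the eigenvalues of
   Y^* Y, with multiplicity and in no particular order. As Y^* Y is positive
   semidefinite, [spectral_diag] lists its eigenvalues and these are
   nonnegative reals, so [complex.Re] loses nothing; see [gram_spectral],
   [gram_spectral_ge0] and [singular_valueE] below. *)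
Definition singular_value Y (j : 'I_m) : R :=
  Num.sqrt (complex.Re (spectral_diag (Y^t* *m Y) 0 j)).

Definition schatten_norm p Y : R :=
  (\sum_(j < m) singular_value Y j `^ p) `^ p^-1.

Definition re_mx Y : 'M[R[i]]_m := 2^-1 *: (Y + Y^t*).

Definition expi theta : R[i] := cos theta +i* sin theta.

(* [sup] is the supremum in R. It is the genuine least upper bound whenever
   the set is bounded above, which is the case here. *)
Definition wp p Y : R :=
  sup [set schatten_norm p (re_mx (expi theta *: Y)) | theta in [set: R]].

Lemma gram_normal Y : Y^t* *m Y \is normalmx.
Proof.
apply: hermitian_normalmx; apply/is_hermitianmxP.
by rewrite expr0 scale1r trmx_mul map_mxM /= trmxCK.
Qed.

Lemma gram_spectral Y (P := spectralmx (Y^t* *m Y)) :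
  P \is unitarymx /\
  Y^t* *m Y = P^t* *m diag_mx (spectral_diag (Y^t* *m Y)) *m P.
Proof.
split; first exact: spectral_unitarymx.
rewrite -invmx_unitary ?spectral_unitarymx //.
exact/orthomx_spectralP/gram_normal.
Qed.

Lemma gram_spectral_ge0 Y (j : 'I_m) : 0 <= spectral_diag (Y^t* *m Y) 0 j.
Proof.
have [/unitarymxP PP gramE] := gram_spectral Y.
set P := spectralmx _ in PP gramE; set d := spectral_diag _ in gramE *.
have dE : diag_mx d = (Y *m P^t*)^t* *m (Y *m P^t*).
  rewrite trmx_mul map_mxM /= trmxCK -mulmxA (mulmxA (Y^t*)) gramE.
  by rewrite !mulmxA PP mul1mx -mulmxA PP mulmx1.
have /matrixP/(_ j j) := dE; rewrite !mxE eqxx mulr1n => ->.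
by apply: sumr_ge0 => k _; rewrite !mxE mulrC mul_conjC_ge0.
Qed.

Lemma singular_valueE Y (j : 'I_m) :
  ((singular_value Y j) ^+ 2)%:C = spectral_diag (Y^t* *m Y) 0 j.
Proof.
have := gram_spectral_ge0 Y j; rewrite /singular_value.
case: (spectral_diag _ 0 j) => a b; rewrite lecE /= => /andP[/eqP -> a0].
by rewrite sqr_sqrtr.
Qed.

End SchattenNumericalRadius.

(* Main.v *)
(** The block matrix with rows [(A, B)] and [(B, A)] is similar to the direct sum
    of [A + B] and [A - B], and its Gram matrix has the same shape. Hence the
    p-th power of its Schatten norm is the sum of those of [A + B] and [A - B],
    and the same holds for real parts since [re_mx] acts blockwise. Bounding each
    summand by its supremum over the angle gives (2), even with the factor
    [2 `^ (1 - 2 / p) >= 1] removed. For [A = 0] the two summands coincide, which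
    gives (1); for Hermitian matrices both suprema are attained at angle [0]. *)

Require Import Defs.
From mathcomp Require Import all_boot all_order all_algebra.
From mathcomp Require Import sesquilinear spectral complex.
From mathcomp Require Import all_classical all_reals all_analysis.

Set Implicit Arguments.
Unset Strict Implicit.

Import Order.TTheory GRing.Theory Num.Theory.
Local Open Scope ring_scope.
Local Open Scope classical_set_scope.
Local Open Scope sesquilinear_scope.
Local Open Scope complex_scope.

(** * Determinants and characteristic polynomials *)

Lemma det_block_mx_circulant (S : comNzRingType) n (P Q : 'M[S]_n) :
  \det (block_mx P Q Q P) = \det (P + Q) * \det (P - Q).
Proof.
(* Subtract the first block row from the second, then add the second block column to the first. Both
   operations have determinant 1 and avoid dividing by 2, so the ring may be a polynomial ring. *)
have E : block_mx 1%:M 0 (- 1%:M) 1%:M *m block_mx P Q Q P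
           *m block_mx 1%:M 0 1%:M 1%:M = block_mx (P + Q) Q 0 (P - Q).
  rewrite !mulmx_block !mul1mx !mul0mx !mulmx0 !mulmx1 !mulNmx !mul1mx !addr0.
  by rewrite !add0r [- P + Q]addrC [- Q + P]addrC addrA subrK subrr.
have := congr1 (fun M => \det M) E.
by rewrite /= !det_mulmx !det_lblock det_ublock !det1 !mul1r !mulr1.
Qed.

Lemma char_poly_block_mx_circulant (S : comNzRingType) n (G H : 'M[S]_n) :
  char_poly (block_mx G H H G) = char_poly (G + H) * char_poly (G - H).
Proof.
rewrite /char_poly /char_poly_mx map_block_mx scalar_mx_block opp_block_mx.
rewrite add_block_mx !add0r det_block_mx_circulant mulrC.
by rewrite !raddfD /= !raddfN /= -!addrA opprK mulrC.
Qed.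

Lemma char_poly_unitary_diag (C : numClosedFieldType) n (P : 'M[C]_n)
    (d : 'rV[C]_n) : P \is unitarymx ->
  char_poly (P^t* *m diag_mx d *m P) = \prod_j ('X - (d 0 j)%:P).
Proof.
move=> PU; have PP : P^t* *m P = 1%:M by rewrite -invmx_unitary ?mulVmx ?unitarymx_unit.
have PPp : map_mx polyC (P^t*) *m map_mx polyC P = 1%:M by rewrite -map_mxM PP map_mx1.
(* The scalar matrix of ['X] commutes with the conjugation by [P], so the whole characteristic
   matrix is conjugated. *)
transitivity (\det (map_mx polyC (P^t*) *m char_poly_mx (diag_mx d) *m map_mx polyC P)).
  rewrite /char_poly /char_poly_mx mulmxBr mulmxBl !map_mxM /=; congr (\det (_ - _)).
  by rewrite mul_mx_scalar -scalemxAl PPp -mul_scalar_mx mulmx1.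
rewrite !det_mulmx mulrAC -det_mulmx PPp det1 mul1r -/(char_poly _).
rewrite char_poly_trig ?diag_mx_is_trig//.
by apply: eq_bigr => j _; rewrite mxE eqxx mulr1n.
Qed.

(** * Powers of Schatten norms *)

Section SchattenSum.
Context {R : realType}.
Implicit Types (p theta : R).

(** The Schatten norm before its outer root is taken; this is the quantity that adds up over direct
    sums. *)
Definition schatten_sum {m} p (Y : 'M[R[i]]_m) : R :=
  \sum_(j < m) singular_value Y j `^ p.

Lemma schatten_sum_ge0 m p (Y : 'M[R[i]]_m) : 0 <= schatten_sum p Y.
Proof. by apply: sumr_ge0 => j _; apply: powR_ge0. Qed.

Lemma schatten_normK m p (Y : 'M[R[i]]_m) :
  p != 0 -> schatten_norm p Y `^ p = schatten_sum p Y.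
Proof. by move=> p0; rewrite -powRrM mulVf// powRr1// schatten_sum_ge0. Qed.

Lemma schatten_norm_le m p (Y : 'M[R[i]]_m) x :
  0 <= p -> schatten_sum p Y <= x -> schatten_norm p Y <= x `^ p^-1.
Proof.
move=> p0 le_x; have S0 := schatten_sum_ge0 p Y.
by apply: ge0_ler_powR; rewrite ?invr_ge0 ?nnegrE// (le_trans S0).
Qed.

Lemma char_poly_gram m (Y : 'M[R[i]]_m) :
  char_poly (Y^t* *m Y) =
  \prod_(x <- [seq spectral_diag (Y^t* *m Y) 0 j | j <- enum 'I_m]) ('X - x%:P).
Proof.
have [PU {1}->] := gram_spectral Y.
by rewrite char_poly_unitary_diag// big_map big_enum.
Qed.

(* [spectral_diag] lists the eigenvalues in an unspecified order, so sums over
   it are compared through the characteristic polynomial. *)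
Lemma schatten_sum_char_poly m p (Y : 'M[R[i]]_m) (s : seq R[i]) :
  char_poly (Y^t* *m Y) = \prod_(x <- s) ('X - x%:P) ->
  schatten_sum p Y = \sum_(x <- s) Num.sqrt (complex.Re x) `^ p.
Proof.
rewrite char_poly_gram => /prod_XsubC_eq/(perm_big _) <-.
by rewrite big_map big_enum.
Qed.

Lemma schatten_sum_unitary_diag m p (Y P : 'M[R[i]]_m) (d : 'rV[R[i]]_m) :
  P \is unitarymx -> Y^t* *m Y = P^t* *m diag_mx d *m P ->
  schatten_sum p Y = \sum_j Num.sqrt (complex.Re (d 0 j)) `^ p.
Proof.
move=> PU YE; rewrite (@schatten_sum_char_poly _ _ _ [seq d 0 j | j <- enum 'I_m]).
  by rewrite big_map big_enum.
by rewrite YE char_poly_unitary_diag// big_map big_enum.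
Qed.

Lemma trmxC_block m (A B C D : 'M[R[i]]_m) :
  (block_mx A B C D)^t* = block_mx (A^t*) (C^t*) (B^t*) (D^t*).
Proof. by rewrite tr_block_mx map_block_mx. Qed.

Lemma schatten_sum_circulant n p (A B : 'M[R[i]]_n) :
  schatten_sum p (block_mx A B B A) = schatten_sum p (A + B) + schatten_sum p (A - B).
Proof.
rewrite (@schatten_sum_char_poly _ _ (block_mx A B B A)
  ([seq spectral_diag ((A + B)^t* *m (A + B)) 0 j | j <- enum 'I_n] ++
   [seq spectral_diag ((A - B)^t* *m (A - B)) 0 j | j <- enum 'I_n])).
  by rewrite big_cat !big_map; congr (_ + _); rewrite big_enum.
rewrite big_cat /= -!char_poly_gram trmxC_block mulmx_block.
(* Reordering the bottom row shows the circulant shape. The sum and the difference of the two blocks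
   are then the Gram matrices of [A + B] and [A - B]. *)
rewrite [B^t* *m B + _]addrC [B^t* *m A + _]addrC char_poly_block_mx_circulant.
congr (_ * _); congr char_poly.
  rewrite [(A + B)^T]raddfD map_mxD mulmxDl !mulmxDr /=.
  by rewrite -!addrA; congr (_ + _); rewrite addrC -!addrA; congr (_ + _); rewrite addrC.
rewrite [(A - B)^T]raddfB map_mxB mulmxBl !mulmxBr /= opprB opprD.
by rewrite -!addrA; congr (_ + _); rewrite addrCA.
Qed.

Lemma schatten_sumZ m p (c : R) (Y : 'M[R[i]]_m) :
  schatten_sum p (c%:C *: Y) = `|c| `^ p * schatten_sum p Y.
Proof.
have [PU YE] := gram_spectral Y.
(* The unitary that diagonalises the Gram matrix of [Y] also serves for the scaled matrix, with
   eigenvalues multiplied by [c ^+ 2]. *)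
rewrite (@schatten_sum_unitary_diag _ _ _ _
  ((c ^+ 2)%:C *: spectral_diag (Y^t* *m Y)) PU).
  rewrite mulr_sumr; apply: eq_bigr => j _; rewrite mxE.
  rewrite -powRM ?sqrtr_ge0//; congr (_ `^ _).
  rewrite /singular_value -sqrtr_sqr -sqrtrM ?sqr_ge0//.
  by case: (spectral_diag _ 0 j) => a b /=; rewrite mul0r subr0.
rewrite [diag_mx _]linearZ [(_ *: Y)^T]linearZ /= map_mxZ.
rewrite -[_ (c%:C)]/(c%:C^*%C) conjc_real.
by rewrite -!scalemxAr -!scalemxAl -YE scalerA -rmorphM.
Qed.


(** * Real parts of rotated matrices *)

Lemma re_mxD m (X Y : 'M[R[i]]_m) : re_mx (X + Y) = re_mx X + re_mx Y.
Proof. by rewrite /re_mx -scalerDr [(X + Y)^T]raddfD map_mxD addrACA. Qed.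

Lemma re_mxN m (X : 'M[R[i]]_m) : re_mx (- X) = - re_mx X.
Proof. by rewrite /re_mx -scalerN [(- X)^T]raddfN map_mxN opprD. Qed.

Lemma schatten_sum_re_circulant n p theta (A B : 'M[R[i]]_n) :
  schatten_sum p (re_mx (expi theta *: block_mx A B B A)) =
  schatten_sum p (re_mx (expi theta *: (A + B))) +
  schatten_sum p (re_mx (expi theta *: (A - B))).
Proof.
rewrite scalerDr scalerBr !re_mxD re_mxN -schatten_sum_circulant; congr schatten_sum.
by rewrite {1}/re_mx scale_block_mx trmxC_block add_block_mx scale_block_mx.
Qed.

Lemma norm_expi theta : `|expi theta| = 1.
Proof. by rewrite normc_def /= cos2Dsin2 sqrtr1. Qed.

(** Each eigenvalue of the Gram matrix is at most the trace, the others being nonnegative. This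
    crude bound serves only to show that the set defining [wp] is bounded above. *)
Lemma schatten_sum_le_trace m p (Y : 'M[R[i]]_m) : 0 <= p ->
  schatten_sum p Y <= Num.sqrt (complex.Re (\tr (Y^t* *m Y))) `^ p *+ m.
Proof.
move=> p0; rewrite -[X in _ *+ X](card_ord m) -sumr_const.
apply: ler_sum => j _.
apply: ge0_ler_powR; rewrite ?nnegrE ?sqrtr_ge0//.
rewrite ler_wsqrtr//.
suff : spectral_diag (Y^t* *m Y) 0 j <= \tr (Y^t* *m Y) by rewrite lecE => /andP[].
have [PU {2}->] := gram_spectral Y.
rewrite mxtrace_mulC mulmxA (unitarymxP PU) mul1mx mxtrace_diag (bigD1 j)//=.
by rewrite lerDl sumr_ge0// => k _; apply: gram_spectral_ge0.
Qed.

(** The trace is the squared Frobenius norm, bounded entrywise by the triangle inequality. As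
    [expi theta] has modulus 1, the bound does not depend on the angle. *)
Lemma trace_gram_re_mx_le m theta (Y Z : 'M[R[i]]_m) :
  Z = re_mx (expi theta *: Y) ->
  \tr (Z^t* *m Z) <= \sum_j \sum_k (2^-1 * (`|Y k j| + `|Y j k|)) ^+ 2.
Proof.
move=> ->; apply: ler_sum => j _; rewrite mxE; apply: ler_sum => k _.
rewrite !mxE mulrC -normCK lerXn2r ?nnegrE ?mulr_ge0 ?addr_ge0 ?invr_ge0 ?ler0n//.
rewrite normrM ger0_norm ?invr_ge0 ?ler0n// ler_wpM2l ?invr_ge0 ?ler0n//.
by rewrite (le_trans (ler_normD _ _))// norm_conjC !normrM norm_expi !mul1r.
Qed.

Lemma schatten_norm_le_wp m p theta (Y : 'M[R[i]]_m) : 0 <= p ->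
  schatten_norm p (re_mx (expi theta *: Y)) <= wp p Y.
Proof.
move=> p0; apply: ub_le_sup; last by exists theta.
(* This angle-free constant yields the upper bound that makes [sup] a genuine supremum. *)
set K := \sum_j \sum_k (2^-1 * (`|Y k j| + `|Y j k|)) ^+ 2.
exists ((Num.sqrt (complex.Re K) `^ p *+ m) `^ p^-1) => _ [t _ <-].
apply: schatten_norm_le => //; apply: le_trans (schatten_sum_le_trace _ p0) _.
rewrite lerMn2r; apply/orP; right.
apply: ge0_ler_powR; rewrite ?nnegrE ?sqrtr_ge0// ler_wsqrtr//.
by have := trace_gram_re_mx_le (erefl (re_mx (expi t *: Y))); rewrite lecE => /andP[].
Qed.

Lemma wp_le m p (Y : 'M[R[i]]_m) (x : R) :
  (forall theta, schatten_norm p (re_mx (expi theta *: Y)) <= x) -> wp p Y <= x.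
Proof.
move=> le_x; apply: ge_sup; last by move=> _ [t _ <-].
by exists (schatten_norm p (re_mx (expi 0 *: Y))); exists 0.
Qed.

Lemma schatten_norm_ge0 m p (Y : 'M[R[i]]_m) : 0 <= schatten_norm p Y.
Proof. exact: powR_ge0. Qed.

Lemma wp_ge0 m p (Y : 'M[R[i]]_m) : 0 <= p -> 0 <= wp p Y.
Proof.
by move=> p0; apply: le_trans (schatten_norm_le_wp 0 Y p0); apply: schatten_norm_ge0.
Qed.

Lemma schatten_sum_le_wp m p theta (Y : 'M[R[i]]_m) : 0 < p ->
  schatten_sum p (re_mx (expi theta *: Y)) <= wp p Y `^ p.
Proof.
move=> p0; have p0' := ltW p0; rewrite -schatten_normK ?gt_eqF//.
by apply: ge0_ler_powR; rewrite ?nnegrE ?wp_ge0 ?schatten_norm_ge0 ?schatten_norm_le_wp.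
Qed.

(** * Numerical radii of circulant block matrices *)

Lemma wp_circulant_le n p (A B : 'M[R[i]]_n) : 0 < p ->
  wp p (block_mx A B B A) <= (wp p (A + B) `^ p + wp p (A - B) `^ p) `^ p^-1.
Proof.
move=> p0; apply: wp_le => t; apply: schatten_norm_le; first exact: ltW.
by rewrite schatten_sum_re_circulant lerD// schatten_sum_le_wp.
Qed.

Lemma schatten_sumN m p (Y : 'M[R[i]]_m) : schatten_sum p (- Y) = schatten_sum p Y.
Proof.
by rewrite /schatten_sum /singular_value [(- Y)^T]raddfN map_mxN mulNmx mulmxN opprK.
Qed.

Lemma wp_antidiag n p (B : 'M[R[i]]_n) : 0 < p ->
  wp p (block_mx 0 B B 0) = 2 `^ p^-1 * wp p B.
Proof.
move=> p0.
have E t : schatten_norm p (re_mx (expi t *: block_mx 0 B B 0)) =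
           2 `^ p^-1 * schatten_norm p (re_mx (expi t *: B)).
  rewrite /schatten_norm -!/(schatten_sum _ _) schatten_sum_re_circulant add0r sub0r.
  by rewrite scalerN re_mxN schatten_sumN -powRM ?schatten_sum_ge0// -mulr2n mulr_natl.
have c0 : 0 < 2 `^ p^-1 :> R by apply: powR_gt0.
(* The positive constant is moved out of the supremum by two inequalities, the second after dividing
   by it. *)
apply/eqP; rewrite eq_le; apply/andP; split.
  by apply: wp_le => t; rewrite E ler_pM2l// schatten_norm_le_wp// ltW.
rewrite -ler_pdivlMl//; apply: wp_le => t.
by rewrite ler_pdivlMl// -E schatten_norm_le_wp// ltW.
Qed.

Lemma re_mx_expi_herm m theta (Y : 'M[R[i]]_m) : Y^t* = Y ->
  re_mx (expi theta *: Y) = (cos theta)%:C *: Y.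
Proof.
move=> YE; rewrite /re_mx [(_ *: Y)^T]linearZ /= map_mxZ YE -scalerDl scalerA.
congr (_ *: _).
(* A complex number plus its conjugate is twice its real part, here [cos theta]. *)
by rewrite /= addcJ mulKf.
Qed.

(** Rotation only scales the real part by [cos theta], whose modulus is at most 1, with value 1 at
    angle 0. *)
Lemma wp_herm m p (Y : 'M[R[i]]_m) : 0 < p -> Y^t* = Y -> wp p Y = schatten_norm p Y.
Proof.
move=> p0 YE; apply/eqP; rewrite eq_le; apply/andP; split.
  apply: wp_le => t; rewrite (re_mx_expi_herm t YE).
  apply: schatten_norm_le; first exact: ltW.
  rewrite schatten_sumZ ler_piMl ?schatten_sum_ge0//.
  have <- : 1 `^ p = 1 by rewrite powR1.
  apply: ge0_ler_powR; rewrite ?nnegrE ?(ltW p0)//.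
  by rewrite ler_norml cos_le1 cos_geN1.
by have := schatten_norm_le_wp 0 Y (ltW p0); rewrite (re_mx_expi_herm 0 YE) cos0 rmorph1 scale1r.
Qed.

Lemma wp_circulant_herm n p (A B : 'M[R[i]]_n) : 0 < p -> A^t* = A -> B^t* = B ->
  wp p (block_mx A B B A) = (wp p (A + B) `^ p + wp p (A - B) `^ p) `^ p^-1.
Proof.
move=> p0 AE BE.
have DE : (A + B)^t* = A + B by rewrite [(A + B)^T]raddfD map_mxD AE BE.
have SE : (A - B)^t* = A - B by rewrite [(A - B)^T]raddfB map_mxB AE BE.
have ME : (block_mx A B B A)^t* = block_mx A B B A by rewrite trmxC_block AE BE.
(* All three matrices are Hermitian, so the claim reduces to additivity of [schatten_sum]. *)
rewrite (wp_herm p0 DE) (wp_herm p0 SE) (wp_herm p0 ME).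
have normK (Y : 'M[R[i]]_n) := schatten_normK Y (lt0r_neq0 p0).
transitivity ((schatten_sum p (A + B) + schatten_sum p (A - B)) `^ p^-1).
  by rewrite -schatten_sum_circulant.
congr (_ `^ _); congr (_ + _); exact/esym/normK.
Qed.

Lemma hermsymmx_trmxC m (Y : 'M[R[i]]_m) : Y \is hermsymmx -> Y^t* = Y.
Proof. by move=> /is_hermitianmxP; rewrite expr0 scale1r => <-. Qed.

End SchattenSum.

Theorem mainTheorem10 (R : realType) (n : nat) (p : R) (hp : 2 <= p)
    (A B : 'M[R[i]]_n) :
  wp p (block_mx 0 B B 0) = 2 `^ (1 / p) * wp p B
  /\
  (wp p (block_mx A B B A) <=
     1 / 2 `^ (2 / p - 1) *
       (wp p (A + B) `^ p + wp p (A - B) `^ p) `^ (1 / p)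
   /\
   (A \is hermsymmx -> B \is hermsymmx ->
    wp p (block_mx A B B A) =
      (wp p (A + B) `^ p + wp p (A - B) `^ p) `^ (1 / p))).
Proof.
have p0 : 0 < p by apply: lt_le_trans hp.
rewrite !div1r; split; first exact: wp_antidiag.
split; last by move=> /hermsymmx_trmxC AE /hermsymmx_trmxC BE; apply: wp_circulant_herm.
apply: le_trans (wp_circulant_le A B p0) _.
(* Since [2 <= p], the exponent [2 / p - 1] is at most 0, so the power of 2 is at most 1 and its
   inverse at least 1. *)
rewrite ler_peMl ?powR_ge0// invf_ge1 ?powR_gt0//.
by rewrite -[leRHS](powRr0 (2 : R)) ler_powR ?ler1n// subr_le0 ler_pdivrMr// mul1r.
Qed.
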